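(* Let $0\le\alpha<1$, $0<\beta\le1$ and let $p$ be real with $p>-1$. If $$2\beta(1-\alpha)\left(1+\frac{p+2}{p+1}\right)-\left(\frac{1+\beta}{(p+1)(p+2)}+\frac{2\left(1+\beta(2-\alpha)\right)}{p+1}+\frac{2\beta(1-\alpha)(p+2)}{p+1}\right)e^{\frac{1}{p+2}}\ \ge\ 0,$$ then $u_p^{(2)}\in K(\alpha,\beta)$.
   Context: $U=\{z\in\mathbb{C}:|z|<1\}$ and $\mathcal{A}$ is the class of analytic functions $f$ on $U$ of the form $f(z)=z+\sum_{k=2}^{\infty}a_kz^k$. For $0\le\alpha<1$, $0<\beta\le1$, $K(\alpha,\beta)$ is the class of $f\in\mathcal{A}$ satisfying $\left|\dfrac{\frac{zf''(z)}{f'(z)}}{\frac{zf''(z)}{f'(z)}+2(1-\alpha)}\right|<\beta$ for all $z\in U$. The normalized modified Bessel function of the first kind of order $p$ is $u_p^{(2)}(z)=\Gamma(p+1)z^{1-\frac p2}I_p(2\sqrt z)=\sum_{k=0}^{\infty}\frac{1}{(p+1)_k}\frac{z^{k+1}}{k!}$, where $(\lambda)_0=1$ and $(\lambda)_k=\lambda(\lambda+1)\cdots(\lambda+k-1)$ for $k\ge1$. *)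

(* Defs.v *)
From HB Require Import structures.
From mathcomp Require Export all_boot all_order all_algebra.
From mathcomp Require Export all_classical all_reals all_analysis.
From mathcomp Require Export complex.
Set Implicit Arguments. Unset Strict Implicit. Unset Printing Implicit Defensive.
Export Order.TTheory GRing.Theory Num.Theory.
Export numFieldNormedType.Exports.
Local Open Scope classical_set_scope.
Local Open Scope ring_scope.
Local Open Scope complex_scope.

(* [R[i]^o] is R[i] seen as a one-dimensional normed
   module over itself; it carries the topology of the modulus, so [derivable]
   and [derive1] below are complex differentiability and complex derivative. *)
Section ClassK.
Context {R : realType}.
Implicit Types (f : R[i]^o -> R[i]^o) (z : R[i]^o).

Definition unit_disk : set R[i]^o := [set z | `|z| < 1].

(* Analytic on U means complex differentiable at every point of U. *)
Definition class_A f : Prop :=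
  (forall z, unit_disk z -> derivable f z 1) /\
  exists a : nat -> R[i]^o,
    [/\ a 0%N = 0, a 1%N = 1
      & forall z, unit_disk z ->
          series (fun k => a k * z ^+ k) @ \oo --> f z].

Definition zf2_div_f1 f z : R[i]^o := z * derive1n 2 f z / derive1 f z.

(* Division is total in MathComp (x / 0 = 0), so the nonvanishing of the two
   denominators, implicit in the usual definition, is required explicitly. *)
Definition class_K (alpha beta : R) f : Prop :=
  class_A f /\
  forall z, unit_disk z ->
    [/\ derive1 f z != 0,
        zf2_div_f1 f z + (2 * (1 - alpha))%:C != 0
      & `|zf2_div_f1 f z / (zf2_div_f1 f z + (2 * (1 - alpha))%:C)|
          < beta%:C].

Definition pochhammer (l : R) (k : nat) : R := \prod_(i < k) (l + i%:R).

(* For p > -1 this equals Gamma(p+1) z^(1-p/2) I_p(2 sqrt z). *)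
Definition bessel_u (p : R) z : R[i]^o :=
  limn (series (fun k : nat =>
    ((pochhammer (p + 1) k)^-1)%:C * (z ^+ k.+1 / (k`!)%:R) : R[i]^o)).

End ClassK.

(* Main.v *)
(* The Bessel function is an entire power series f with nonnegative
   coefficients, which can be differentiated termwise.  On the disk,
   |z f''| <= |z| T1 and |f' - 1| <= |z| T2, where T1 and T2 are the values at 1
   of the series of f'' and f' - 1.  Hence
   (1 + beta) T1 + 2 beta (1 - alpha) T2 <= 2 beta (1 - alpha) implies
   |z f''| < beta |z f'' + 2 (1 - alpha) f'|.  This bound on T1 and T2 follows
   from the hypothesis, because (p + 1)_(k+1) >= (p + 1) (p + 2)^k compares them
   with the exponential series at 1 / (p + 2). *)
Require Import Defs.
From mathcomp Require Import ring lra.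
Set Implicit Arguments. Unset Strict Implicit. Unset Printing Implicit Defensive.
Local Open Scope ring_scope.
Local Open Scope complex_scope.
Local Open Scope classical_set_scope.

Section PowerSeries.
Context {R : realType}.
Implicit Types (a b : nat -> R) (u : nat -> R[i]^o) (z h : R[i]^o).

(** * Moduli, which here are values of [R[i]], and limits of complex sequences *)

Lemma norm_complexP z : exists2 r : R, 0 <= r & `|z| = r%:C.
Proof.
by rewrite normc_def; eexists; last reflexivity; exact: sqrtr_ge0.
Qed.

Lemma gtc0P z : 0 < z -> exists2 e : R, 0 < e & z = e%:C.
Proof.
move=> z0; exists (complex.Re z); last by rewrite RRe_real // gtr0_real.
by move: z0; rewrite ltcE => /andP[].
Qed.

Lemma norm_real_complex (x : R) : `|x%:C| = `|x|%:C :> R[i].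
Proof. by rewrite normc_def /= expr0n addr0 sqrtr_sqr. Qed.

Lemma cvg_real_complex a (l : R) : a @ \oo --> l ->
  (fun n => (a n)%:C : R[i]^o) @ \oo --> (l%:C : R[i]^o).
Proof.
move=> /cvgrPdist_le al; apply/cvgrPdist_le => _/gtc0P[e e0 ->].
by apply: filterS (al _ e0) => n; rewrite -rmorphB norm_real_complex lecR.
Qed.

(** The order of [R[i]] is only partial, so the bound passes to the limit through the real value of
    the modulus. *)
Lemma norm_lim_le u z (c : R) : u @ \oo --> z ->
  (forall n, `|u n| <= c%:C) -> `|z| <= c%:C.
Proof.
move=> /cvgrPdist_le uz uc; have [r r0 rE] := norm_complexP z.
rewrite rE lecR; apply/ler_addgt0Pr => e e0; rewrite -lecR -rE rmorphD/=.
have e0' : 0 < (e%:C : R[i]^o) by rewrite (ltcR 0).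
have [N _ /(_ N (leqnn N)) H] := uz _ e0'.
rewrite -(subrK (u N) z) addrC (le_trans (ler_normD _ _))// lerD//.
Qed.

Lemma normc_ge_Im (x : R[i]) : `|complex.Im x|%:C <= `|x|.
Proof.
rewrite normc_def lecR -sqrtr_sqr ler_wsqrtr// lerDr sqr_ge0 //.
Qed.

(** The real and imaginary parts are each dominated by [b], so both real series converge absolutely;
    they are then recombined. *)
Lemma is_cvg_series_complex u b : (forall n, `|u n| <= (b n)%:C) ->
  cvgn (series b) -> cvgn (series u).
Proof.
move=> ub cb.
have cvg_part (v : nat -> R) : (forall n, `|v n| <= b n) -> cvgn (series v).
  by move=> vb; apply: normed_cvg; apply: series_le_cvg cb => [n|n|//];
    [exact: normr_ge0|exact: le_trans (vb n)].
have cRe : cvgn (series (fun n => complex.Re (u n))).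
  by apply: cvg_part => n; rewrite -lecR; apply: le_trans (ub n);
    exact: normc_ge_Re.
have cIm : cvgn (series (fun n => complex.Im (u n))).
  by apply: cvg_part => n; rewrite -lecR; apply: le_trans (ub n);
    exact: normc_ge_Im.
have -> : series u = fun n => (series (fun n => complex.Re (u n)) n)%:C +
    ('i%C : R[i]^o) * (series (fun n => complex.Im (u n)) n)%:C.
  apply/funext => n; rewrite !seriesEord /= !rmorph_sum mulr_sumr -big_split/=.
  by apply: eq_bigr => i _; rewrite [LHS]complexE.
apply: cvgP; apply: cvgD; first exact: cvg_real_complex cRe.
apply: cvgM; first exact: cvg_cst.
exact: cvg_real_complex cIm.
Qed.

(** * Entire power series and their termwise differentiation *)

(* The coefficients of an entire series of exponential type at most D; this
   class is stable under termwise differentiation. *)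
Definition exp_type a := exists C D : R,
  0 <= D /\ forall k, 0 <= a k <= C * (D ^+ k / k`!%:R).

Definition power_sum a z : R[i]^o :=
  limn (series (fun k => (a k)%:C * z ^+ k : R[i]^o)).

Definition deriv_coef a k := k.+1%:R * a k.+1.

Lemma exp_type_ge0 a : exp_type a -> forall k, 0 <= a k.
Proof. by move=> [C [D [_ aP]]] k; case/andP: (aP k). Qed.

(** Comparison with [C] times the exponential series at [D * M]. *)
Lemma exp_type_cvg a (M : R) : exp_type a -> 0 <= M ->
  cvgn (series (fun k => a k * M ^+ k)).
Proof.
move=> [C [D [D0 aP]]] M0.
have le_aM k : 0 <= a k * M ^+ k <= C * exp_coeff (D * M) k.
  have /andP[a0 ak] := aP k; rewrite mulr_ge0 ?exprn_ge0//=.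
  by rewrite /exp_coeff/= exprMn mulrAC mulrA ler_wpM2r ?exprn_ge0.
apply: (@series_le_cvg _ _ (fun k => C * exp_coeff (D * M) k)).
- by move=> k; case/andP: (le_aM k).
- by move=> k; case/andP: (le_aM k); exact: le_trans.
- by move=> k; case/andP: (le_aM k).
have -> : series (fun k => C * exp_coeff (D * M) k)
    = (fun n => C * series (exp_coeff (D * M)) n).
  by apply/funext => n; rewrite !seriesEord/= mulr_sumr.
by apply: is_cvgM; [exact: is_cvg_cst|exact: is_cvg_series_exp_coeff].
Qed.

Lemma exp_type_deriv a : exp_type a -> exp_type (deriv_coef a).
Proof.
move=> [C [D [D0 aP]]]; exists (C * D), D; split=> // k.
have /andP[a0 ak] := aP k.+1; rewrite mulr_ge0//=.
apply: le_trans (ler_wpM2l _ ak) _ => //.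
rewrite factS natrM invfM exprS; set x := _^-1.
have x0 : k.+1%:R != 0 :> R by rewrite pnatr_eq0.
rewrite le_eqVlt; apply/orP; left; apply/eqP.
have k0 : k`!%:R != 0 :> R by rewrite pnatr_eq0 -lt0n fact_gt0.
rewrite /x -[k.+1]addn1 natrD in x0 *; field.
by rewrite k0 x0.
Qed.

Lemma power_sum_cvg a z : exp_type a ->
  series (fun k => (a k)%:C * z ^+ k : R[i]^o) @ \oo --> power_sum a z.
Proof.
move=> ha; have [r r0 rE] := norm_complexP z.
suff : cvgn (series (fun k => (a k)%:C * z ^+ k : R[i]^o)) by [].
apply: (is_cvg_series_complex _ (exp_type_cvg ha r0)) => k.
rewrite normrM normrX rE norm_real_complex ger0_norm ?exp_type_ge0//.
by rewrite -rmorphXn -rmorphM.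
Qed.

(** Induction on [k]: if E_k is the Taylor remainder, then E_(k+1) = (z + h) E_k + h^2 k z^(k-1).
    The factor 2 in [2 * M] leaves room for the second term, since k <= 2^k. *)
Lemma pow_taylor (M : R) z h k : 1 <= M -> `|z| <= M%:C -> `|z + h| <= M%:C ->
  `|(z + h) ^+ k - z ^+ k - k%:R * h * z ^+ k.-1|
     <= `|h| ^+ 2 * ((2 * M) ^+ k)%:C.
Proof.
move=> M1 zM zhM; have M0 : 0 <= M by rewrite (le_trans _ M1).
elim: k => [|k IH].
  by rewrite !expr0 subrr mul0r mul0r subr0 normr0 mulr_ge0// sqr_ge0.
(* For [k = 0] the truncated exponent [k.-1] is harmless, because its term carries the factor
   [k%:R]. *)
have -> : (z + h) ^+ k.+1 - z ^+ k.+1 - k.+1%:R * h * z ^+ k =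
    (z + h) * ((z + h) ^+ k - z ^+ k - k%:R * h * z ^+ k.-1)
    + h ^+ 2 * (k%:R * z ^+ k.-1).
  by case: k {IH} => [|k] /=; rewrite ?expr0 ?exprS -?natr1; ring.
apply: le_trans (ler_normD _ _) _.
rewrite (normrM (z + h)) (normrM (h ^+ 2)) (normrM k%:R).
apply: le_trans (lerD (ler_pM _ _ zhM IH) (lexx _)) _ => //.
rewrite [`|h ^+ 2|]normrX mulrCA -mulrDr ler_wpM2l ?exprn_ge0//.
rewrite [`|z ^+ _|]normrX normr_nat.
apply: (@le_trans _ _ ((M * (2 * M) ^+ k + k%:R * M ^+ k)%:C)).
  rewrite rmorphD !rmorphM lerD// rmorph_nat ler_wpM2l// rmorphXn.
  apply: (@le_trans _ _ (M%:C ^+ k.-1)).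
    by rewrite lerXn2r ?nnegrE// ler0c.
  by rewrite ler_weXn2l ?leq_pred// lecR.
rewrite lecR (_ : _ ^+ k.+1 = M * (2 * M) ^+ k + M * (2 * M) ^+ k).
  2: by rewrite exprS; ring.
rewrite lerD2l.
rewrite exprMn mulrA [M * _]mulrC -mulrA -exprS.
apply: (@le_trans _ _ (2 ^+ k * M ^+ k)).
  by rewrite ler_wpM2r ?exprn_ge0// -natrX ler_nat ltnW// ltn_expl.
by rewrite ler_wpM2l ?exprn_ge0// ler_weXn2l.
Qed.

(** Summing [pow_taylor] against the coefficients gives S = sum of a_k (2M)^k, which is finite and
    independent of [h]. *)
Lemma power_sum_taylor a z (M : R) : exp_type a -> 1 <= M -> `|z| <= M%:C ->
  exists2 S : R, 0 <= S & forall h (r : R), `|h| = r%:C -> `|z + h| <= M%:C ->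
    `|power_sum a (z + h) - power_sum a z - h * power_sum (deriv_coef a) z|
      <= (r ^+ 2 * S)%:C.
Proof.
move=> ha M1 zM; have M0 : 0 <= M by rewrite (le_trans _ M1).
have cS : cvgn (series (fun k => a k * (2 * M) ^+ k)).
  by apply: exp_type_cvg => //; rewrite mulr_ge0.
have a0 := exp_type_ge0 ha.
have t0 k : 0 <= a k * (2 * M) ^+ k by rewrite mulr_ge0 ?exprn_ge0 ?mulr_ge0.
have leS n : series (fun k => a k * (2 * M) ^+ k) n <=
    limn (series (fun k => a k * (2 * M) ^+ k)).
  by apply: nondecreasing_cvgn_le => //; exact: nondecreasing_series.
exists (limn (series (fun k => a k * (2 * M) ^+ k))).
  by apply: le_trans (leS 0%N); rewrite seriesEord/= big_ord0.
move=> h r hr zhM.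
pose e k : R[i]^o := (a k)%:C * ((z + h) ^+ k - z ^+ k - k%:R * h * z ^+ k.-1).
apply: (norm_lim_le (u := fun n => series e n.+1)); last first.
  move=> n; rewrite rmorphM rmorphXn/= -hr.
  apply: le_trans (_ : _ <=
      `|h| ^+ 2 * (series (fun k => a k * (2 * M) ^+ k) n.+1)%:C) _; last first.
    by rewrite ler_wpM2l ?exprn_ge0// lecR.
  rewrite !seriesEord /= rmorph_sum mulr_sumr (le_trans (ler_norm_sum _ _ _))//.
  apply: ler_sum => k _; rewrite /e normrM norm_real_complex.
  rewrite (ger0_norm (a0 k)) rmorphM mulrCA.
  by rewrite ler_wpM2l ?ler0c// pow_taylor.
(* The term of index 0 in [e] vanishes, so n + 1 terms of the two power series pair with n terms of
   the derived one. *)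
have -> : (fun n => series e n.+1) = (fun n =>
    series (fun k => (a k)%:C * (z + h) ^+ k : R[i]^o) n.+1
    - series (fun k => (a k)%:C * z ^+ k : R[i]^o) n.+1
    - h * series (fun k => (deriv_coef a k)%:C * z ^+ k : R[i]^o) n).
  apply/funext => n; rewrite !seriesEord /= [in RHS]big_ord_recl.
  rewrite [X in _ - X - _]big_ord_recl [LHS]big_ord_recl opprD addrACA.
  rewrite -[RHS]addrA; congr (_ + _).
    by rewrite /e /= !expr0; ring.
  rewrite mulr_sumr -!sumrB; apply: eq_bigr => k _.
  by rewrite /e /deriv_coef lift0 /= rmorphM rmorph_nat; ring.
apply: cvgB; first apply: cvgB.
- by rewrite (cvg_shiftS (series _)); exact: power_sum_cvg.
- by rewrite (cvg_shiftS (series _)); exact: power_sum_cvg.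
apply: cvgM; first exact: cvg_cst.
exact: power_sum_cvg (exp_type_deriv ha).
Qed.

(** Division by |h| turns the quadratic remainder into |h| S, which tends to 0. *)
Lemma power_sum_deriv_cvg a z : exp_type a ->
  (fun h => h^-1 *: (power_sum a (h + z) - power_sum a z) : R[i]^o) @ 0^' -->
    power_sum (deriv_coef a) z.
Proof.
move=> ha; have [r r0 rE] := norm_complexP z.
have [||S S0 HS] := @power_sum_taylor a z (r + 1) ha.
- by rewrite lerDr.
- by rewrite rE lecR lerDl.
(* [S] may vanish; [S + 1] is a safe divisor when choosing how small [h] must be. *)
have S1 : 0 < S + 1 by rewrite ltr_wpDl.
apply/cvgrPdist_le => _/gtc0P[e e0 ->]; near=> h.
have [s s0 sE] := norm_complexP h.
have h0 : h != 0 by near: h; exact: nbhs_dnbhs_neq.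
have s1 : s <= 1.
  by rewrite -lecR -sE; near: h; apply: dnbhs0_le; rewrite ltr01.
have se : s * S <= e.
  apply: (@le_trans _ _ (s * (S + 1))); first by rewrite ler_wpM2l// lerDl.
  rewrite -ler_pdivlMr// -lecR -sE; near: h; apply: dnbhs0_le.
  by rewrite (ltcR 0) divr_gt0.
have s_gt0 : 0 < s by rewrite -ltcR -sE normr_gt0.
have zhM : `|z + h| <= (r + 1)%:C.
  by rewrite (le_trans (ler_normD _ _))// rE sE -rmorphD lecR lerD2l.
rewrite -(ler_pM2l (x := `|h|)) ?normr_gt0// -normrM mulrBr.
rewrite -[h^-1 *: _]/(h^-1 * _) mulrA divff// mul1r distrC addrC [h + z]addrC.
rewrite addrC (le_trans (HS _ _ sE zhM))// sE -rmorphM lecR expr2 -mulrA.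
by rewrite ler_wpM2l.
Unshelve. all: by end_near. Qed.

Lemma power_sum_derivable a z : exp_type a -> derivable (power_sum a) z 1.
Proof.
move=> ha; have := power_sum_deriv_cvg (z := z) ha.
set f := (X in X @ _); move=> fz.
rewrite /derivable (_ : (fun h => _) = f); first exact: cvgP fz.
by apply/funext => h; rewrite /f /= -[h *: 1]/(h * 1) mulr1.
Qed.

Lemma power_sum_derive1 a : exp_type a ->
  derive1 (power_sum a) = power_sum (deriv_coef a).
Proof.
move=> ha; apply/funext => z; apply: cvg_lim; first exact: norm_hausdorff.
exact: power_sum_deriv_cvg.
Qed.

Lemma exp_type_cvg1 a : exp_type a -> cvgn (series a).
Proof.
move=> ha; rewrite -(_ : (fun k => a k * 1 ^+ k) = a).
  exact: exp_type_cvg.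
by apply/funext => k; rewrite expr1n mulr1.
Qed.

(** * Estimates on the disk and a coefficient criterion for [class_K] *)

(** Since r^(k+1) <= r for r <= 1, one factor r comes out of the whole tail. This factor later
    yields strict inequalities from r < 1. *)
Lemma power_sum_bound a z (r : R) : exp_type a -> `|z| = r%:C -> r <= 1 ->
  `|power_sum a z - (a 0%N)%:C| <= (r * (limn (series a) - a 0%N))%:C.
Proof.
move=> ha rE r1; have a0 := exp_type_ge0 ha; have ca := exp_type_cvg1 ha.
have r0 : 0 <= r by rewrite -ler0c -rE.
have sz : (fun n => series (fun k => (a k)%:C * z ^+ k : R[i]^o) n.+1) @ \oo -->
    power_sum a z.
  by rewrite (cvg_shiftS (series _)); exact: power_sum_cvg.
apply: (norm_lim_le (cvgB sz (cvg_cst ((a 0%N)%:C : R[i]^o)))).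
move=> n; apply: (@le_trans _ _ (r * (series a n.+1 - a 0%N))%:C); last first.
  rewrite lecR ler_wpM2l// lerD2r; apply: nondecreasing_cvgn_le => //.
  exact: nondecreasing_series.
rewrite -[X in `|X|]/(
  series (fun k => (a k)%:C * z ^+ k : R[i]^o) n.+1 - (a 0%N)%:C).
rewrite !seriesEord/= !big_ord_recl/= expr0 mulr1.
rewrite ![_ + _ - _]addrAC !subrr !add0r mulr_sumr.
rewrite rmorph_sum (le_trans (ler_norm_sum _ _ _))//; apply: ler_sum => k _.
rewrite normrM norm_real_complex (ger0_norm (a0 _)) rmorphM/= mulrC.
rewrite ler_wpM2r ?ler0c// normrX rE -rmorphXn lecR.
by rewrite /bump exprS ler_piMr// exprn_ile1.
Qed.

Lemma class_A_power_sum a : exp_type a -> a 0%N = 0 -> a 1%N = 1 ->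
  class_A (power_sum a).
Proof.
move=> ha a0 a1; split; first by move=> z _; exact: power_sum_derivable.
exists (fun k => (a k)%:C); split; rewrite ?a0 ?a1//.
by move=> z _; exact: power_sum_cvg.
Qed.

(** The hypothesis bounds the partial sums of (1 + beta) T1 + beta L T2 by beta L, where L = 2 (1 -
    alpha). *)
Lemma class_K_power_sum (alpha beta : R) a : 0 <= alpha < 1 -> 0 < beta <= 1 ->
  exp_type a -> a 0%N = 0 -> a 1%N = 1 ->
  (forall n, \sum_(k < n)
      k.+2%:R * (k.+1%:R * (1 + beta) + 2 * beta * (1 - alpha)) * a k.+2
    <= 2 * beta * (1 - alpha)) ->
  class_K alpha beta (power_sum a).
Proof.
move=> /andP[al0 al1] /andP[be0 be1] ha a0 a1 acoef.
split; first exact: class_A_power_sum.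
move=> z z1; have {z1} : `|z| < 1 := z1.
have [r r0 rE] := norm_complexP z; rewrite rE (ltcR r 1) => r1.
pose b := deriv_coef a; pose d := deriv_coef b.
have hb : exp_type b := exp_type_deriv ha.
have hd : exp_type d := exp_type_deriv hb.
rewrite /zf2_div_f1 /= power_sum_derive1// -/b power_sum_derive1// -/d.
have b0 : b 0%N = 1 by rewrite /b/deriv_coef a1 mulr1.
set f1 := power_sum b z; set f2 := power_sum d z.
set L := 2 * (1 - alpha).
have L0 : 0 < L by rewrite /L; lra.
pose T1 := limn (series d); pose T2 := limn (series b) - 1.
have T12 : (1 + beta) * T1 + beta * L * T2 <= beta * L.
  (* With (k+1)(k+2) a_(k+2) = d_k and (k+2) a_(k+2) = b_(k+1), this is the sum in [acoef]; the
     series of [b] runs one term further because its first term 1 is subtracted. *)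
  have cu : (fun n => (1 + beta) * series d n + beta * L * (series b n.+1 - 1))
      @ \oo --> (1 + beta) * T1 + beta * L * T2.
    apply: cvgD; apply: cvgM;
      [exact: cvg_cst|exact: exp_type_cvg1|exact: cvg_cst|].
    apply: cvgB; last exact: cvg_cst.
    by rewrite (cvg_shiftS (series _)); exact: exp_type_cvg1.
  rewrite -(cvg_lim (@norm_hausdorff _ _) cu).
  apply: limr_le; first exact: cvgP cu.
  apply: nearW => n; have := acoef n.
  rewrite !seriesEord/= big_ord_recl b0 addrAC subrr add0r !mulr_sumr.
  rewrite -big_split/=.
  rewrite (_ : 2 * beta * (1 - alpha) = beta * L); last by rewrite /L; ring.
  apply: le_trans; rewrite le_eqVlt; apply/orP; left; apply/eqP.
  apply: eq_bigr => k _; rewrite /bump /= add1n /d /b /deriv_coef; ring.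
have T1_ge0 : 0 <= T1.
  apply: le_trans (_ : series d 0 <= _); first by rewrite seriesEord/= big_ord0.
  apply: nondecreasing_cvgn_le (exp_type_cvg1 hd) _.
  by apply: nondecreasing_series => n *; exact: exp_type_ge0.
have rT12 : r * ((1 + beta) * T1 + beta * L * T2) < beta * L.
  apply: le_lt_trans (ler_wpM2l r0 T12) _.
  by rewrite gtr_pMl// mulr_gt0.
(* Dropping the nonnegative T1 term leaves this bound, which keeps f' away from 0. *)
have rT2 : r * T2 < 1.
  have : beta * L * (r * T2) < beta * L * 1.
    have : 0 <= r * ((1 + beta) * T1) by rewrite !mulr_ge0// addr_ge0// ltW.
    move: rT12; rewrite mulr1; move: (beta * L) => BL.
    move: ((1 + beta) * T1) => Y.
    by nra.
  by rewrite ltr_pM2l// mulr_gt0.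
have f1E : `|f1 - 1| <= (r * T2)%:C.
  by have := power_sum_bound hb rE (ltW r1); rewrite b0.
have f2E : `|f2| <= T1%:C.
  have d0 : 0 <= d 0%N := exp_type_ge0 hd 0.
  rewrite -(subrK (d 0%N)%:C f2); apply: le_trans (ler_normD _ _) _.
  apply: le_trans (lerD (power_sum_bound hd rE (ltW r1)) (lexx _)) _.
  rewrite norm_real_complex ger0_norm// -rmorphD lecR -/T1.
  (* The bound reached is r (T1 - d_0) + d_0, at most T1 once d_0 <= T1. *)
  have dT : d 0%N <= T1.
    apply: le_trans (_ : series d 1 <= _).
      by rewrite seriesEord/= big_ord1.
    apply: nondecreasing_cvgn_le (exp_type_cvg1 hd) _.
    by apply: nondecreasing_series => n *; exact: exp_type_ge0.
  nra.
have [m m0 mE] := norm_complexP f1.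
have [s s0 sE] := norm_complexP (z * f2).
have [w w0 wE] := norm_complexP (z * f2 + L%:C * f1).
have le_m : 1 - r * T2 <= m.
  rewrite lerBlDr -lecR rmorphD/= -mE.
  apply: le_trans (lerD (lexx _) f1E); apply: le_trans (ler_normB _ _).
  by rewrite subKr normr1.
have le_s : s <= r * T1.
  by rewrite -lecR -sE normrM rE rmorphM ler_wpM2l ?ler0c.
have le_w : L * m - s <= w.
  rewrite lerBlDl -lecR rmorphD rmorphM/= -mE -sE -wE.
  have -> : L%:C * `|f1| = `|L%:C * f1|.
    by rewrite normrM norm_real_complex (ger0_norm (ltW L0)).
  rewrite [leRHS]addrC; apply: le_trans (ler_normB _ _).
  by rewrite addrAC subrr add0r.
have m_gt0 : 0 < m by apply: lt_le_trans le_m; rewrite subr_gt0.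
have f1N : f1 != 0 by rewrite -normr_gt0 mE (ltcR 0).
(* (1 + beta) s <= (1 + beta) r T1 < beta L (1 - r T2) <= beta L m, hence s < beta (L m - s) <= beta
   w. *)
have sw : s < beta * w.
  have h1 : beta * (L * m - s) <= beta * w by rewrite ler_wpM2l// ltW.
  have h2 : beta * L * (1 - r * T2) <= beta * L * m.
    by rewrite ler_wpM2l// mulr_ge0// ltW.
  have h3 : (1 + beta) * s <= (1 + beta) * (r * T1).
    by rewrite ler_wpM2l// addr_ge0// ltW.
  by move: h1 h2 h3 rT12; lra.
have w_gt0 : 0 < w by rewrite -(pmulr_rgt0 _ be0); exact: le_lt_trans s0 sw.
have WN : z * f2 + L%:C * f1 != 0 by rewrite -normr_gt0 wE (ltcR 0).
have qE : z * f2 / f1 + L%:C = (z * f2 + L%:C * f1) / f1.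
  by rewrite mulrDl mulfK.
have qN : z * f2 / f1 + L%:C != 0 by rewrite qE mulf_neq0// invr_eq0.
split=> //.
have -> : z * f2 / f1 / (z * f2 / f1 + L%:C) = z * f2 / (z * f2 + L%:C * f1).
  by rewrite qE invf_div mulrA divfK.
by rewrite normrM normfV sE wE ltr_pdivrMr ?(ltcR 0)// -rmorphM ltcR.
Qed.

(** * Coefficients of the Bessel function and their comparison with the exponential *)

Definition bessel_coef (p : R) k : R :=
  if k is n.+1 then (pochhammer (p + 1) n)^-1 / n`!%:R else 0.

Lemma pochhammer_gt0 (l : R) k : 0 < l -> 0 < pochhammer l k.
Proof. by move=> l0; apply: prodr_gt0 => i _; rewrite ltr_wpDr. Qed.

(** The first factor is l and each of the k others is at least l + 1. *)
Lemma pochhammer_ge (l : R) k : 0 < l -> l * (l + 1) ^+ k <= pochhammer l k.+1.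
Proof.
move=> l0; rewrite /pochhammer big_ord_recl addr0 ler_pM2l//.
rewrite -[X in _ ^+ X]card_ord -prodr_const; apply: ler_prod => i _.
by rewrite addr_ge0 ?(ltW l0)//= lerD2l ler1n.
Qed.

Lemma inv_pochhammer_le (l : R) k : 0 < l ->
  (pochhammer l k.+1)^-1 <= l^-1 * ((l + 1)^-1) ^+ k.
Proof.
move=> l0; have l1 : 0 < l + 1 by rewrite addr_gt0.
rewrite exprVn -invfM lef_pV2 ?posrE ?pochhammer_ge ?pochhammer_gt0//.
by rewrite mulr_gt0 ?exprn_gt0.
Qed.

Lemma fact_neq0 k : k`!%:R != 0 :> R.
Proof. by rewrite pnatr_eq0 -lt0n fact_gt0. Qed.

Lemma exp_type_bessel (p : R) : -1 < p -> exp_type (bessel_coef p).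
Proof.
move=> hp; have q0 : 0 < p + 1 by lra.
have q1 : 0 < p + 1 + 1 by lra.
(* Writing 1/n! = (n+1)/(n+1)! with n + 1 <= 2^(n+1) gives the 2 in [D]. The Pochhammer bound
   supplies only n - 1 powers of 1/(p+2), against n + 1 in D^(n+1), whence the square in [C]. *)
exists ((p + 1)^-1 * (p + 1 + 1) ^+ 2), (2 * (p + 1 + 1)^-1).
split; first by rewrite mulr_ge0// invr_ge0 ltW.
case=> [|n] /=.
  by rewrite lexx expr0 !mulr_ge0 ?invr_ge0// ltW// ?exprn_gt0.
have pn : 0 <= (pochhammer (p + 1) n)^-1.
  by rewrite invr_ge0 ltW// pochhammer_gt0.
rewrite divr_ge0//=.
have le_pn : (pochhammer (p + 1) n)^-1 <=
    (p + 1)^-1 * (p + 1 + 1) * ((p + 1 + 1)^-1) ^+ n.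
  case: n {pn} => [|n].
    by rewrite /pochhammer big_ord0 expr0 invr1 mulr1 mulrC ler_pdivlMr//; lra.
  apply: le_trans (inv_pochhammer_le n q0) _.
  by rewrite exprS mulrA mulfK// lt0r_neq0.
have n2 : n.+1%:R <= 2 ^+ n.+1 :> R by rewrite -natrX ler_nat ltnW// ltn_expl.
have -> : (pochhammer (p + 1) n)^-1 / n`!%:R =
    n.+1%:R * (pochhammer (p + 1) n)^-1 / (n.+1)`!%:R.
  rewrite factS natrM invfM mulrA [n.+1%:R * _]mulrC mulfK// pnatr_eq0.
rewrite mulrA ler_wpM2r ?invr_ge0//.
apply: le_trans (ler_pM _ pn n2 le_pn) _ => //.
rewrite le_eqVlt; apply/orP; left; apply/eqP.
rewrite exprMn [(_^-1) ^+ n.+1]exprS expr2; field.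
by rewrite !lt0r_neq0//; lra.
Qed.

Lemma bessel_uE (p : R) : -1 < p -> bessel_u p = power_sum (bessel_coef p).
Proof.
move=> /exp_type_bessel hp; apply/funext => z.
apply: cvg_lim; first exact: norm_hausdorff.
(* The coefficient of index 0 is zero, so the partial sums agree after a shift by one. *)
have := power_sum_cvg (z := z) hp; rewrite -(cvg_shiftS (series _)).
set f := (X in X @ _ --> _ -> _) => fz.
rewrite (_ : series _ = f)//; apply/funext => n.
rewrite /f !seriesEord/= big_ord_recl mul0r add0r; apply: eq_bigr => k _.
by rewrite /bump /= rmorphM [X in _ * X * _]fmorphV rmorph_nat mulrA mulrAC.
Qed.

Lemma sum_exp_coeff_le (x : R) n : 0 <= x ->
  \sum_(k < n) x ^+ k / k`!%:R <= expR x.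
Proof.
move=> x0; have -> : \sum_(k < n) x ^+ k / k`!%:R = series (exp_coeff x) n.
  by rewrite seriesEord.
apply: nondecreasing_cvgn_le (is_cvg_series_exp_coeff x) _.
by apply: nondecreasing_series => k *; exact: exp_coeff_ge0.
Qed.

(** With x = 1/(p+2) and E_k = x^k/k!, the k-th term is at most (A k E_k + (2A + B) E_k + B (p+2)
    E_(k+1)) / (p+1). The three sums are bounded by x e^x, e^x and e^x - 1. *)
Lemma bessel_coef_sum (A B p : R) n : -1 < p -> 0 <= A -> 0 <= B ->
  \sum_(k < n) k.+2%:R * (k.+1%:R * A + B) * bessel_coef p k.+2 <=
  (A / ((p + 1) * (p + 2)) + (2 * A + B) / (p + 1)
    + B * (p + 2) / (p + 1)) * expR (1 / (p + 2)) - B * (p + 2) / (p + 1).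
Proof.
move=> hp A0 B0; have q0 : 0 < p + 1 by lra.
have q1 : 0 < p + 2 by lra.
rewrite div1r; set x := (p + 2)^-1; have x0 : 0 < x by rewrite invr_gt0.
pose E k := x ^+ k / k`!%:R.
have E0 k : 0 <= E k by rewrite divr_ge0// exprn_ge0// ltW.
have sE := sum_exp_coeff_le _ (ltW x0).
have -> : (A / ((p + 1) * (p + 2)) + (2 * A + B) / (p + 1)
    + B * (p + 2) / (p + 1)) * expR x - B * (p + 2) / (p + 1) =
    (p + 1)^-1 * (A * (x * expR x)
    + (2 * A + B) * expR x + B * (p + 2) * (expR x - 1)).
  by rewrite /x; field; rewrite !lt0r_neq0.
apply: (@le_trans _ _ ((p + 1)^-1 * (A * (\sum_(k < n) k%:R * E k)
    + (2 * A + B) * (\sum_(k < n) E k) + B * (p + 2) * (\sum_(k < n) E k.+1)))).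
  rewrite !mulr_sumr -!big_split/= mulr_sumr; apply: ler_sum => k _.
  apply: (@le_trans _ _ (k.+2%:R * (k.+1%:R * A + B) *
      ((p + 1)^-1 * x ^+ k / (k.+1)`!%:R))).
    apply: ler_wpM2l; first by rewrite mulr_ge0// addr_ge0// mulr_ge0.
    rewrite ler_wpM2r ?invr_ge0//.
    by have := inv_pochhammer_le k q0; rewrite -addrA.
  rewrite le_eqVlt; apply/orP; left; apply/eqP.
  rewrite /E [x ^+ k.+1]exprS factS natrM /x; have kf := fact_neq0 k.
  have k1 : k.+1%:R != 0 :> R by rewrite pnatr_eq0.
  move: k1; rewrite -[k.+2]addn2 -[k.+1]addn1 !natrD => k1.
  by field; rewrite kf k1 !lt0r_neq0.
rewrite ler_pM2l ?invr_gt0//; apply: lerD; first apply: lerD.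
(* The term k = 0 vanishes, and (k+1) E_(k+1) = x E_k. *)
- apply: ler_wpM2l => //; case: n => [|n].
    by rewrite big_ord0 mulr_ge0 ?expR_ge0// ltW.
  rewrite big_ord_recl mul0r add0r (le_trans _ (ler_wpM2l (ltW x0) (sE n)))//.
  rewrite mulr_sumr; apply: ler_sum => k _; rewrite lift0 /E.
  rewrite exprS factS natrM le_eqVlt; apply/orP; left; apply/eqP.
  have kf := fact_neq0 k.
  have k1 : k.+1%:R != 0 :> R by rewrite pnatr_eq0.
  move: k1; rewrite -[k.+1]addn1 natrD => k1.
  by field; rewrite kf k1.
- by apply: ler_wpM2l (sE n); rewrite addr_ge0// mulr_ge0.
- apply: ler_wpM2l; first by rewrite mulr_ge0// ltW.
  by rewrite lerBrDr; have := sE n.+1;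
    rewrite big_ord_recl /= expr0 fact0 divr1 addrC.
Qed.
End PowerSeries.

Theorem corollary11 (R : realType) (alpha beta p : R)
  (halpha : 0 <= alpha < 1) (hbeta : 0 < beta <= 1) (hp : -1 < p)
  (hcond : 0 <= 2 * beta * (1 - alpha) * (1 + (p + 2) / (p + 1))
    - ((1 + beta) / ((p + 1) * (p + 2))
       + 2 * (1 + beta * (2 - alpha)) / (p + 1)
       + 2 * beta * (1 - alpha) * (p + 2) / (p + 1)) * expR (1 / (p + 2))) :
  class_K alpha beta (bessel_u p).
Proof.
rewrite bessel_uE//; apply: class_K_power_sum => //.
- exact: exp_type_bessel.
- by rewrite /bessel_coef /pochhammer big_ord0 invr1 mul1r.
move: halpha hbeta => /andP[al0 al1] /andP[be0 be1] n.
(* Taken with A = 1 + beta and B = 2 beta (1 - alpha); moving B (p+2)/(p+1) across turns the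
   required bound by B into [hcond]. *)
apply: le_trans (bessel_coef_sum _ hp _ _) _.
- lra.
- by rewrite !mulr_ge0//; lra.
have -> : 2 * (1 + beta) + 2 * beta * (1 - alpha) =
    2 * (1 + beta * (2 - alpha)).
  by ring.
by move: hcond; rewrite mulrDr mulr1 mulrA; lra.
Qed.
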